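(* The digraph $D^*$ (defined in the context) belongs to $\mathscr{D}(3,3)$, and its edges cannot be covered by four directed cuts; that is, there do not exist four bipartitions $(A_1,B_1),\ldots,(A_4,B_4)$ of $V(D^* )$ such that $E(D^* )=\bigcup_{i=1}^4 E(A_i,B_i)$.
   Context: Digraphs are directed graphs without loops and without parallel edges (two edges in opposite directions between the same pair of vertices are allowed). $V(D)$ and $E(D)$ denote the vertex set and edge set of $D$; $uv$ denotes an edge directed from $u$ to $v$. For nonnegative integers $k$ and $l$, $\mathscr{D}(k,l)$ denotes the family of digraphs in which every vertex has either indegree at most $k$ or outdegree at most $l$. For a bipartition $(X,Y)$ of $V(D)$ (a partition of $V(D)$ into two disjoint, possibly empty, sets $X$ and $Y$), the directed cut induced by $(X,Y)$ is $E(X,Y)=\{xy\in E(D) : x\in X,\ y\in Y\}$. Construction of $D^*$: Let $D_1$ be the orientation of the complete graph $K_7$ with vertices $x_1,\ldots,x_7$ in which the out-neighbors of $x_i$ are exactly $x_{i+1},x_{i+2},x_{i+3}$ (indices modulo 7). Let $D_2$ be a disjoint copy of $D_1$ with vertices $y_1,\ldots,y_7$, so that the out-neighbors of $y_i$ within $D_2$ are $y_{i+1},y_{i+2},y_{i+3}$ (indices modulo 7). For each of the 35 three-element subsets $\{x_i,x_j,x_k\}$ of $V(D_1)$ add a new vertex $z_{i,j,k}$ (one vertex for each subset) together with the edges $x_iz_{i,j,k}$, $x_jz_{i,j,k}$, $x_kz_{i,j,k}$; let $Z$ be the set of these 35 new vertices. Finally, add an edge from each vertex of $V(D_1)\cup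 Z$ to each vertex of $V(D_2)$. The resulting digraph is $D^*$. *)

(* Defs.v *)
From HB Require Import structures.
From mathcomp Require Import all_boot all_order all_algebra.
Set Implicit Arguments.
Unset Strict Implicit.
Unset Printing Implicit Defensive.

(* Being given by an adjacency relation, a digraph has no parallel edges;
   opposite edges between two vertices are allowed. *)
Record digraph := Digraph {
  vertex :> finType;
  edge : rel vertex;
  edge_irr : irreflexive edge
}.

Definition edges (D : digraph) : {set D * D} := [set e | edge e.1 e.2].

Definition indeg (D : digraph) (v : D) : nat := #|[set u : D | edge u v]|.
Definition outdeg (D : digraph) (v : D) : nat := #|[set w : D | edge v w]|.

Definition in_Dkl (k l : nat) (D : digraph) : Prop :=
  forall v : D, indeg v <= k \/ outdeg v <= l.

Definition bipartition (D : digraph) (X Y : {set D}) : Prop :=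
  X :&: Y = set0 /\ X :|: Y = [set: D].

Definition dicut (D : digraph) (X Y : {set D}) : {set D * D} :=
  [set e in edges D | (e.1 \in X) && (e.2 \in Y)].

(* Indices 1..7 modulo 7 are the elements of 'Z_7, with 7 represented by 0. *)
Definition circ7 : rel 'Z_7 :=
  fun i j => j \in [set (i + 1)%R; (i + 2%:R)%R; (i + 3%:R)%R].

Definition triple := {T : {set 'Z_7} | #|T| == 3}.

(* The three summands are the x_i, the y_i and the z_T, for T the set of
   indices of a three-element set of x's. *)
Definition Dstar_vertex : finType := ('Z_7 + 'Z_7 + triple)%type.

Definition Dstar_edge : rel Dstar_vertex := fun u v =>
  match u, v with
  | inl (inl i), inl (inl j) => circ7 i j      (* x_i -> x_j *)
  | inl (inr i), inl (inr j) => circ7 i j      (* y_i -> y_j *)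
  | inl (inl i), inr T => i \in val T          (* x_i -> z_T *)
  | inl (inl _), inl (inr _) => true           (* x_i -> y_j *)
  | inr _, inl (inr _) => true                 (* z_T -> y_j *)
  | _, _ => false
  end.

Lemma circ7_irr : irreflexive circ7.
Proof.
move=> i; rewrite /circ7 !inE.
by case: i; do 7![case=> [|]//].
Qed.

Lemma Dstar_irr : irreflexive Dstar_edge.
Proof. by case=> [[i|i]|T] //=; apply: circ7_irr. Qed.

Definition Dstar : digraph := Digraph Dstar_irr.

(* Main.v *)
Require Import Defs.
From HB Require Import structures.
From mathcomp Require Import all_boot all_order all_algebra.

(** A cover of the edges by k directed cuts is the same thing as a map c from
    the vertices to the subsets of a k-element set, namely the set of cuts whose
    first side contains the vertex, such that c u is never included in c v when
    uv is an edge.  So let c be such a map on D*, with k = 4.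

    Both c o x and c o y are injective, since D_1 and D_2 are tournaments; the
    full set is not some c x_i, since x_i has an in-neighbour, and the empty set
    is not some c y_j, since y_j has an out-neighbour.  Let U be the family of
    the subsets included in no c y_j.  It is closed under supersets and contains
    every c x_i, every c z_T and the full set, so it has at least 8 members; it
    avoids every c y_j and the empty set, so it has at most 8 of the 16 subsets.
    Hence U consists of the full set and the seven c x_i
    (lemma [upper_colorsE]).

    Because of the vertices z_T, for any three of the c x_i some member of U
    includes none of them.  So U contains no singleton {a}, for then U would be
    the family of all supersets of {a}, with the single minimal member {a}; by
    counting, it then contains all four 3-sets, and therefore exactly three
    2-sets.  Taking for T the indices of these three 2-sets, c z_T has to be a
    3-set including none of them, which means that the 2-sets are the three pairs through some
    element a (lemma [pairs_through_point]).

    Let b, d, e be the three other elements.  The pair {a, d} is included in the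
    complement of {b}, so the vertex coloured by the latter dominates the one
    coloured by the former, and the same holds for any two of b, d, e.  Thus D_1
    would contain three vertices and, for each two of them, a common
    out-neighbour, all six being distinct.  The circular tournament on seven
    vertices has no such configuration (lemma [circ7_no_crown]).

    As for the degrees, each x_i and each z_T has three in-neighbours, and each
    y_j has three out-neighbours. *)

Set Implicit Arguments.
Unset Strict Implicit.
Unset Printing Implicit Defensive.

Import GRing.Theory.

(** * Directed cuts as set colourings *)

Definition separating (D : digraph) (k : nat) (c : D -> {set 'I_k}) : Prop :=
  forall u v : D, edge u v -> ~~ (c u \subset c v).

Lemma dicut_cover_separating (D : digraph) (k : nat) (A B : 'I_k -> {set D}) :
    (forall i, bipartition (A i) (B i)) ->
    edges D = \bigcup_(i < k) dicut (A i) (B i) ->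
  separating (fun v => [set i | v \in A i]).
Proof.
move=> bipAB cover u v uv; apply/subsetPn.
have : (u, v) \in edges D by rewrite inE.
rewrite cover => /bigcupP [i _]; rewrite !inE /= => /andP [_ /andP [uA vB]].
exists i; rewrite inE //; apply/negP => vA.
have [disjAB _] := bipAB i.
by have := in_set0 v; rewrite -disjAB inE vA vB.
Qed.

(** * The circular tournament on seven vertices *)

Lemma circ7E (i j : 'Z_7) : circ7 i j = ((j + 7 - i) %% 7 \in [:: 1; 2; 3]).
Proof.
rewrite /circ7 !inE.
by case: i => [[|[|[|[|[|[|[|m]]]]]]] lt_i7] //;
   case: j => [[|[|[|[|[|[|[|n]]]]]]] lt_j7] //.
Qed.

Lemma circ7_total (i j : 'Z_7) : i != j -> circ7 i j || circ7 j i.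
Proof.
rewrite !circ7E.
by case: i => [[|[|[|[|[|[|[|m]]]]]]] lt_i7] //;
   case: j => [[|[|[|[|[|[|[|n]]]]]]] lt_j7] //.
Qed.

Lemma circ7_succ (i : 'Z_7) : circ7 i (i + 1)%R.
Proof. by rewrite /circ7 !inE eqxx. Qed.

(** Two vertices at cyclic distance 3 have no common out-neighbour, so t1, t2
    and t3 would be consecutive, say i, i+1 and i+2; but outside of these three
    vertices i+3 is the only common out-neighbour both of i, i+1 and of i, i+2.
    The proof checks the finitely many cases. *)
Lemma circ7_no_crown (t1 t2 t3 p1 p2 p3 : 'Z_7) :
    uniq [:: t1; t2; t3; p1; p2; p3] ->
    circ7 t1 p2 -> circ7 t1 p3 -> circ7 t2 p1 -> circ7 t2 p3 ->
    circ7 t3 p1 -> ~~ circ7 t3 p2.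
Proof.
rewrite -(map_inj_uniq val_inj) !circ7E /=.
pose r i j := (j + 7 - i) %% 7 \in [:: 1; 2; 3].
(* The edges into b1 and b2 are tested before the next vertex is chosen, which
   prunes the 7 ^ 6 cases. *)
have check : all (fun a1 => all (fun a2 => all (fun a3 =>
    all (fun b1 => ~~ (r a2 b1 && r a3 b1) || all (fun b2 =>
    ~~ r a1 b2 || all (fun b3 =>
      [&& uniq [:: a1; a2; a3; b1; b2; b3], r a1 b3 & r a2 b3] ==> ~~ r a3 b2)
    (iota 0 7)) (iota 0 7)) (iota 0 7)) (iota 0 7)) (iota 0 7)) (iota 0 7).
  by vm_compute.
have check_at (q : pred nat) (i : 'Z_7) : all q (iota 0 7) -> q i.
  by move=> /allP; apply; rewrite mem_iota; apply: ltn_ord.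
move=> uniq_tp t12 t13 t21 t23 t31.
move: check => /(check_at _ t1) /(check_at _ t2) /(check_at _ t3).
move=> /(check_at _ p1); rewrite {1 2}/r t21 t31 orFb => /(check_at _ p2).
rewrite {1}/r t12 orFb => /(check_at _ p3).
by rewrite /r t13 t23 !andbT => /implyP/(_ uniq_tp).
Qed.

(** * Degrees *)

Lemma card_set3_le (T : finType) (a b d : T) : #|[set a; b; d]| <= 3.
Proof.
by rewrite -setUA cardsU1 cards2; case: (a \notin _); case: (b != d).
Qed.

Lemma Dstar_in_D33 : in_Dkl 3 3 Dstar.
Proof.
case=> [[i|i]|T].
- left; pose N := [set (i - 1)%R; (i - 2%:R)%R; (i - 3%:R)%R].
  apply: leq_trans (card_set3_le (i - 1)%R (i - 2%:R)%R (i - 3%:R)%R).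
  apply: leq_trans (leq_imset_card (fun j => inl (inl j) : Dstar) N).
  apply/subset_leq_card/subsetP => -[[j|j]|T]; rewrite inE //= => ij.
  apply: imset_f; move: ij; rewrite /circ7 !inE.
  by case/orP => [/orP [] | ] /eqP ->; rewrite addrK eqxx ?orbT.
- right; pose N := [set (i + 1)%R; (i + 2%:R)%R; (i + 3%:R)%R].
  apply: leq_trans (card_set3_le (i + 1)%R (i + 2%:R)%R (i + 3%:R)%R).
  apply: leq_trans (leq_imset_card (fun j => inl (inr j) : Dstar) N).
  apply/subset_leq_card/subsetP => -[[j|j]|T]; rewrite inE //= => ij.
  exact: imset_f.
- left; have le3 : #|val T| <= 3 by rewrite (eqP (valP T)).
  apply: leq_trans le3.
  apply: leq_trans (leq_imset_card (fun j => inl (inl j) : Dstar) (val T)).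
  apply/subset_leq_card/subsetP => -[[j|j]|T']; rewrite inE //= => ij.
  exact: imset_f.
Qed.

(** * The colours available above the second tournament *)

Definition xcolor (c : Dstar -> {set 'I_4}) (i : 'Z_7) : {set 'I_4} :=
  c (inl (inl i)).

Definition ycolor (c : Dstar -> {set 'I_4}) (i : 'Z_7) : {set 'I_4} :=
  c (inl (inr i)).

Definition upper_colors (c : Dstar -> {set 'I_4}) : {set {set 'I_4}} :=
  [set S : {set 'I_4} | [forall j, ~~ (S \subset ycolor c j)]].

Lemma circ7_color_inj (f : 'Z_7 -> {set 'I_4}) :
  (forall i j, circ7 i j -> ~~ (f i \subset f j)) -> injective f.
Proof.
move=> sep_f i j fij; apply/eqP; apply: contraT => /circ7_total.
by case/orP => /sep_f; rewrite fij subxx.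
Qed.

Lemma xcolor_sep c : separating c ->
  forall i j, circ7 i j -> ~~ (xcolor c i \subset xcolor c j).
Proof. by move=> sep_c i j ij; apply: sep_c. Qed.

Lemma ycolor_sep c : separating c ->
  forall i j, circ7 i j -> ~~ (ycolor c i \subset ycolor c j).
Proof. by move=> sep_c i j ij; apply: sep_c. Qed.

Lemma xcolor_inj c : separating c -> injective (xcolor c).
Proof. by move=> /xcolor_sep/circ7_color_inj. Qed.

Lemma ycolor_inj c : separating c -> injective (ycolor c).
Proof. by move=> /ycolor_sep/circ7_color_inj. Qed.

Lemma xcolor_neqT c i : separating c -> xcolor c i != setT.
Proof.
move=> sep_c; apply/eqP => xT.
have := xcolor_sep sep_c (circ7_succ (i - 1)%R).
by rewrite subrK xT subsetT.
Qed.

Lemma ycolor_neq0 c i : separating c -> ycolor c i != set0.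
Proof.
move=> sep_c; apply/eqP => y0.
by have := ycolor_sep sep_c (circ7_succ i); rewrite y0 sub0set.
Qed.

Lemma upper_colorsS c (S S' : {set 'I_4}) :
  S \subset S' -> S \in upper_colors c -> S' \in upper_colors c.
Proof.
move=> sSS'; rewrite !inE => /forallP US; apply/forallP => j.
by apply: contra (US j); apply: subset_trans.
Qed.

Lemma zcolor_upper (c : Dstar -> {set 'I_4}) (T : triple) :
  separating c -> c (inr T) \in upper_colors c.
Proof. by move=> sep_c; rewrite inE; apply/forallP => j; apply: sep_c. Qed.

Lemma card_Z7 : #|'Z_7| = 7. Proof. exact: card_ord. Qed.

Lemma card_colors : #|{set 'I_4}| = 16.
Proof. by rewrite -cardsT -powersetT card_powerset cardsT card_ord. Qed.

Lemma card_upper_colorsC c : separating c -> 8 <= #|~: upper_colors c|.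
Proof.
move=> sep_c; have card_y : #|set0 |: [set ycolor c j | j : 'Z_7]| = 8.
  rewrite cardsU1 card_imset ?card_Z7; last exact: ycolor_inj.
  case: imsetP => // -[j _ /eqP]; rewrite eq_sym => y0.
  by have := ycolor_neq0 j sep_c; rewrite y0.
rewrite -{1}card_y; apply/subset_leq_card/subsetP => S.
rewrite !inE negb_forall => /orP [/eqP-> | /imsetP [j _ ->]]; apply/existsP.
  by exists 0%R; rewrite negbK sub0set.
by exists j; rewrite negbK.
Qed.

Lemma card_upper_colors_le c : separating c -> #|upper_colors c| <= 8.
Proof.
move=> sep_c; rewrite -(leq_add2r 8); apply: (@leq_trans 16) => //.
by rewrite -card_colors -(cardsC (upper_colors c)) leq_add2l card_upper_colorsC.
Qed.

Lemma card_setT_xcolors c : separating c ->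
  #|setT |: [set xcolor c i | i : 'Z_7]| = 8.
Proof.
move=> sep_c; rewrite cardsU1 card_imset ?card_Z7; last exact: xcolor_inj.
case: imsetP => // -[i _ /eqP]; rewrite eq_sym => xT.
by have := xcolor_neqT i sep_c; rewrite xT.
Qed.

(** The right-hand side has 8 members and is included in the left-hand side,
    which has at most 8. *)
Lemma upper_colorsE c : separating c ->
  upper_colors c = setT |: [set xcolor c i | i : 'Z_7].
Proof.
move=> sep_c; apply/esym/eqP; rewrite eqEcard; apply/andP; split.
  apply/subsetP => S; rewrite !inE => /orP [/eqP-> | /imsetP [i _ ->]].
    apply/forallP => j; apply: contra (xcolor_neqT 0%R sep_c) => yT.
    have := sep_c (inl (inl 0%R)) (inl (inr j)) isT.
    by rewrite (subset_trans (subsetT _) yT).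
  by apply/forallP => j; apply: sep_c.
by rewrite card_setT_xcolors // card_upper_colors_le.
Qed.

Lemma upper_colorsP c S : separating c -> S \in upper_colors c -> S != setT ->
  exists i, S = xcolor c i.
Proof.
move=> sep_c; rewrite upper_colorsE // => /setU1P [-> | /imsetP [i _ ->] _].
  by rewrite eqxx.
by exists i.
Qed.

Lemma xcolor_upper c i : separating c -> xcolor c i \in upper_colors c.
Proof. by move=> sep_c; rewrite upper_colorsE // setU1r ?imset_f. Qed.

(** * The shape of the available colours *)

Lemma exists_triple (i : 'Z_7) : exists T : triple, i \in val T.
Proof.
pose A := [set i; (i + 1)%R; (i + 2%:R)%R]; have A3 : #|A| == 3.
  rewrite {}/A -setUA cardsU1 cards2 !inE.
  by case: i => [[|[|[|[|[|[|[|m]]]]]]] lt_i7] //.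
by exists (exist _ A A3 : triple); rewrite !inE eqxx.
Qed.

(** If {a} were available, then so would be the 8 supersets of {a}, and nothing
    else; but {a} is the colour of some x_i, and for T through i the available
    colour c z_T does not contain a. *)
Lemma set1_not_upper c a : separating c -> [set a] \notin upper_colors c.
Proof.
move=> sep_c; apply/negP => Ua.
have sU : [set S : {set 'I_4} | a \in S] \subset upper_colors c.
  apply/subsetP => S; rewrite inE => aS.
  by apply: upper_colorsS Ua; rewrite sub1set.
have card_a : #|[set S : {set 'I_4} | a \in S]| = 8.
  have -> : [set S : {set 'I_4} | a \in S] = ~: powerset (~: [set a]).
    by apply/setP => S; rewrite !inE subsetC sub1set inE negbK.
  by rewrite cardsCs setCK card_powerset cardsC1 card_colors card_ord.
have defU : [set S : {set 'I_4} | a \in S] = upper_colors c.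
  by apply/eqP; rewrite eqEcard sU card_a card_upper_colors_le.
have aT : [set a] != setT :> {set 'I_4}.
  apply/eqP => /(congr1 (fun S : {set 'I_4} => #|S|)).
  by rewrite cards1 cardsT card_ord.
have [i xi] := upper_colorsP sep_c Ua aT.
have [T iT] := exists_triple i.
have := sep_c (inl (inl i)) (inr T) iT; rewrite -/(xcolor c i) -xi sub1set.
by have := zcolor_upper T sep_c; rewrite -defU inE => ->.
Qed.

(** Otherwise the 8 subsets of this 3-set would be exactly the colours that are
    not available, and the singleton {a} would be available. *)
Lemma setC1_upper c a : separating c -> ~: [set a] \in upper_colors c.
Proof.
move=> sep_c; apply: contraT => nUa.
have sC : powerset (~: [set a]) \subset ~: upper_colors c.
  apply/subsetP => S; rewrite powersetE inE => sSa.
  by apply: contra nUa; apply: upper_colorsS.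
have cardU : #|upper_colors c| = 8.
  by rewrite upper_colorsE // card_setT_xcolors.
have defC : powerset (~: [set a]) = ~: upper_colors c.
  apply/eqP; rewrite eqEcard sC cardsCs setCK cardU card_colors.
  by rewrite card_powerset cardsC1 card_ord.
have : [set a] \in ~: upper_colors c by rewrite inE set1_not_upper.
by rewrite -defC powersetE sub1set !inE eqxx.
Qed.

Lemma setC1_xcolor c a : separating c -> exists i, ~: [set a] = xcolor c i.
Proof.
move=> sep_c; apply: upper_colorsP (setC1_upper a sep_c) _ => //.
apply/eqP => /(congr1 (fun S : {set 'I_4} => #|S|)).
by rewrite cardsC1 cardsT card_ord.
Qed.

Lemma card3_setC1 (S : {set 'I_4}) : #|S| = 3 -> exists a, S = ~: [set a].
Proof.
move=> S3; have /eqP/cards1P [a Sa] : #|~: S| = 1.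
  by rewrite cardsCs setCK S3 card_ord.
by exists a; rewrite -Sa setCK.
Qed.

Lemma card_xcolor c i : separating c -> #|xcolor c i| = 2 \/ #|xcolor c i| = 3.
Proof.
move=> sep_c; have Ux := xcolor_upper i sep_c.
have lt4 : #|xcolor c i| < 4.
  have := proper_card (_ : xcolor c i \proper setT); rewrite cardsT card_ord.
  by apply; rewrite properEneq xcolor_neqT ?subsetT.
have n1 : #|xcolor c i| != 1.
  apply/negP => /cards1P [a xa].
  by have := set1_not_upper a sep_c; rewrite -xa Ux.
have n0 : #|xcolor c i| != 0.
  rewrite cards_eq0; apply/negP => /eqP x0.
  have := set1_not_upper ord0 sep_c.
  by rewrite (upper_colorsS _ Ux) // x0 sub0set.
by move: n0 n1 lt4; case: #|_| => [|[|[|[|]]]] //; [left | right].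
Qed.

(** The other colours of the x_i are the four 3-sets, all of them available. *)
Lemma card_xcolor2 c : separating c -> #|[set i | #|xcolor c i| == 2]| = 3.
Proof.
move=> sep_c; apply: (@addIn 4); rewrite -[RHS]card_Z7.
rewrite -(cardsC [set i | #|xcolor c i| == 2]); congr (_ + _).
rewrite -(card_imset _ (xcolor_inj sep_c)).
rewrite -[LHS]/('C(4, 3)) -[X in 'C(X, _)]card_ord -card_draws.
apply: eq_card => S; rewrite inE; apply/eqP/imsetP.
  move=> S3; have [a Sa] := card3_setC1 S3.
  have [i xi] := setC1_xcolor a sep_c.
  by exists i; rewrite ?Sa // !inE -xi -Sa S3.
by case=> i; rewrite !inE => i2 ->; case: (card_xcolor i sep_c) i2 => ->.
Qed.

(** Here T is the set of the indices of the 2-sets: c z_T includes none of these,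
    so it is the complement of some {a}, and all of them contain a.  As there are
    three, they are all the pairs through a. *)
Lemma pairs_through_point c : separating c ->
  exists a, forall b, b != a -> exists i, [set a; b] = xcolor c i.
Proof.
move=> sep_c; pose P := [set i | #|xcolor c i| == 2].
have P3 : #|P| == 3 by rewrite card_xcolor2.
pose T : triple := exist _ P P3; set W := c (inr T).
have sepW i : i \in P -> ~~ (xcolor c i \subset W).
  by move=> iP; apply: (sep_c (inl (inl i)) (inr T)).
have WT : W != setT.
  have /set0Pn [i /sepW] : P != set0 by rewrite -card_gt0 (eqP P3).
  by apply: contra => /eqP ->; apply: subsetT.
have [k Wk] := upper_colorsP sep_c (zcolor_upper T sep_c) WT.
have W3 : #|W| = 3.
  case: (card_xcolor k sep_c); rewrite -Wk // => W2.
  by have := sepW k; rewrite inE -Wk subxx W2 => /(_ isT).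
have [a Wa] := card3_setC1 W3; exists a.
have aP i : i \in P -> a \in xcolor c i.
  by move/sepW; rewrite Wa subsetC sub1set inE negbK.
pose Q := [set [set a; b] | b in ~: [set a]].
have sxQ : [set xcolor c i | i in P] \subset Q.
  apply/subsetP => S /imsetP [i iP ->]; have ai := aP i iP.
  move: iP; rewrite inE => /cards2P [u [v [uv xi]]].
  move: ai; rewrite xi => /set2P [] au; apply/imsetP.
    by exists v; rewrite ?au // !inE eq_sym.
  by exists u; rewrite ?au ?inE // setUC.
have defQ : [set xcolor c i | i in P] = Q.
  apply/eqP; rewrite eqEcard sxQ card_imset; last exact: xcolor_inj.
  rewrite (eqP P3); apply: leq_trans (leq_imset_card _ _) _.
  by rewrite cardsC1 card_ord.
move=> b ba; have : [set a; b] \in Q by apply: imset_f; rewrite !inE.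
by rewrite -defQ => /imsetP [i _ ->]; exists i.
Qed.

(** * Four cuts do not suffice *)

Lemma Dstar_not_separating (c : Dstar -> {set 'I_4}) : ~ separating c.
Proof.
move=> sep_c; have [a pairs] := pairs_through_point sep_c.
have pair_dom b d t p : b != a -> d != b ->
    ~: [set b] = xcolor c t -> [set a; d] = xcolor c p -> circ7 t p.
  move=> ba db xt xp.
  have sub_pt : xcolor c p \subset xcolor c t.
    by rewrite -xt -xp subUset !sub1set !inE db eq_sym ba.
  have tp : t != p.
    apply/eqP => tp; move: (congr1 (fun S : {set 'I_4} => #|S|) xt).
    rewrite tp -xp cardsC1 card_ord cards2.
    by case: (a != d).
  have /orP [// | /(xcolor_sep sep_c)] := circ7_total tp.
  by rewrite sub_pt.
have cardC : #|~: [set a]| == 3 by rewrite cardsC1 card_ord.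
have : uniq (enum (~: [set a])) by apply: enum_uniq.
have memC b : b \in enum (~: [set a]) -> b != a by rewrite mem_enum !inE.
move: cardC memC; rewrite cardE.
case: (enum _) => [|b1 [|b2 [|b3 [|]]]] // _ memC.
rewrite /= !inE negb_or andbT => /andP [/andP [b12 b13] b23].
have b1a : b1 != a by apply: memC; rewrite !inE eqxx.
have b2a : b2 != a by apply: memC; rewrite !inE eqxx orbT.
have b3a : b3 != a by apply: memC; rewrite !inE eqxx !orbT.
have [[p1 xp1] [p2 xp2]] := (pairs b1 b1a, pairs b2 b2a).
have [p3 xp3] := pairs b3 b3a.
have [[t1 xt1] [t2 xt2]] := (setC1_xcolor b1 sep_c, setC1_xcolor b2 sep_c).
have [t3 xt3] := setC1_xcolor b3 sep_c.
have [b21 b31 b32] : [/\ b2 != b1, b3 != b1 & b3 != b2].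
  by split; rewrite eq_sym.
have uniq_tp : uniq [:: t1; t2; t3; p1; p2; p3].
  apply: (@map_uniq _ _ (xcolor c)).
  rewrite /= -xt1 -xt2 -xt3 -xp1 -xp2 -xp3.
  have card_neq b d : d != a -> (~: [set b] == [set a; d]) = false.
    move=> da; apply/eqP => /(congr1 (fun S : {set 'I_4} => #|S|)).
    by rewrite cardsC1 card_ord cards2 eq_sym da.
  have setC1_neq b d : b != d -> (~: [set b] == ~: [set d]) = false.
    by move=> bd; rewrite (inj_eq (@setC_inj _)) (inj_eq set1_inj) (negPf bd).
  have pair_neq b d : b != a -> b != d -> ([set a; b] == [set a; d]) = false.
    move=> ba bd; apply/eqP => /setP /(_ b).
    by rewrite !inE eqxx (negPf ba) (negPf bd).
  by rewrite !inE !card_neq // !setC1_neq // !pair_neq.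
have t32 : circ7 t3 p2 by apply: pair_dom xt3 xp2.
apply: (negP _ t32); apply: (circ7_no_crown uniq_tp).
- exact: pair_dom xt1 xp2.
- exact: pair_dom xt1 xp3.
- exact: pair_dom xt2 xp1.
- exact: pair_dom xt2 xp3.
- exact: pair_dom xt3 xp1.
Qed.

Theorem mainTheorem2 :
  in_Dkl 3 3 Dstar /\
  ~ (exists A B : 'I_4 -> {set Dstar},
       (forall i : 'I_4, bipartition (A i) (B i)) /\
       edges Dstar = \bigcup_(i < 4) dicut (A i) (B i)).
Proof.
split; first exact: Dstar_in_D33.
case=> A [B [bipAB cover]].
exact: Dstar_not_separating (dicut_cover_separating bipAB cover).
Qed.
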